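(* Let $G$ be a graph of order $n$. Then: (1) $IC(G)=1$ if and only if $G\simeq K_1$. (2) $IC(G)=2$ if and only if $G\simeq K_2$ or $G\simeq\overline{K}_n$ for some $n\ge 2$.
   Context: Graphs are finite and simple with nonempty vertex set. $K_n$ is the complete graph of order $n$, and $\overline{K}_n$ is its complement, the edgeless graph of order $n$. A set $S$ of vertices is dominating if every vertex is in $S$ or adjacent to a vertex of $S$; it is independent if its vertices are pairwise nonadjacent; an independent dominating set is a set that is both independent and dominating. An independent coalition in $G$ consists of two disjoint independent sets of vertices $V_1,V_2$, neither of which is an independent dominating set but whose union $V_1\cup V_2$ is an independent dominating set; one says that $V_1$ and $V_2$ form an independent coalition. An $ic$-partition of $G$ is a partition $\pi=\{V_1,\dots,V_k\}$ of $V(G)$ into nonempty sets such that every $V_i\in\pi$ either is a singleton dominating set (a dominating set of cardinality 1), or is not an independent dominating set but forms an independent coalition with another set $V_j\in\pi$. The independent coalition number $IC(G)$ is the maximum number of classes of an $ic$-partition of $G$; the assertion $IC(G)=t$ includes that $G$ has an $ic$-partition. *)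

(* Defs.v *)
From mathcomp Require Import all_boot.

Set Implicit Arguments.
Unset Strict Implicit.
Unset Printing Implicit Defensive.

(* Nonemptiness of the vertex set is not a field: it is left as a hypothesis,
   so that complete graphs are defined for every n, including 0. *)
Record sgraph := SGraph {
  vertex :> finType;
  adj : rel vertex;
  adj_sym : symmetric adj;
  adj_irr : irreflexive adj }.

Definition isomorphic (G H : sgraph) : Prop :=
  exists2 f : G -> H, bijective f & forall x y, adj (f x) (f y) = adj x y.

Lemma complete_sym n : symmetric [rel x y : 'I_n | x != y].
Proof. by move=> x y /=; rewrite eq_sym. Qed.

Lemma complete_irr n : irreflexive [rel x y : 'I_n | x != y].
Proof. by move=> x /=; rewrite eqxx. Qed.

Definition complete (n : nat) : sgraph :=
  SGraph (@complete_sym n) (@complete_irr n).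

Lemma complement_sym (G : sgraph) :
  symmetric [rel x y : G | (x != y) && ~~ adj x y].
Proof. by move=> x y /=; rewrite eq_sym adj_sym. Qed.

Lemma complement_irr (G : sgraph) :
  irreflexive [rel x y : G | (x != y) && ~~ adj x y].
Proof. by move=> x /=; rewrite eqxx. Qed.

Definition complement (G : sgraph) : sgraph :=
  SGraph (@complement_sym G) (@complement_irr G).

Section IndependentCoalition.
Variable G : sgraph.
Implicit Types (S V W : {set G}) (P : {set {set G}}).

Definition dominating S : bool :=
  [forall x, (x \in S) || [exists y in S, adj x y]].

Definition independent S : bool :=
  [forall x in S, forall y in S, ~~ adj x y].

Definition independent_dominating S : bool := independent S && dominating S.

Definition independent_coalition V W : bool :=
  [&& [disjoint V & W], independent V, independent W,
      ~~ independent_dominating V, ~~ independent_dominating W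
    & independent_dominating (V :|: W)].

Definition ic_partition P : bool :=
  partition P [set: G] &&
  [forall V in P,
     ((#|V| == 1) && dominating V) ||
     (~~ independent_dominating V &&
      [exists W in P :\ V, independent_coalition V W])].

(* None when G has no ic-partition, so that IC = Some t asserts existence. *)
Definition IC : option nat :=
  if [exists P, ic_partition P] then Some (\max_(P | ic_partition P) #|P|)
  else None.

End IndependentCoalition.

(* Main.v *)
Require Import Defs.
From mathcomp Require Import all_boot.

(** Two extreme kinds of graph govern small values of [IC].

    In a complete graph every vertex dominates, so the partition into singletons
    is an [ic]-partition; since no partition has more classes than vertices,
    [IC] equals the order ([IC_complete]).  In an edgeless graph the only
    dominating set is the whole vertex set, so two classes forming a coalition
    must exhaust the graph; an [ic]-partition therefore has exactly two classes
    as soon as there are two vertices ([edgeless_ic_partition_le2], [IC_edgeless]).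

    Conversely, an [ic]-partition with a single class leaves no partner for a
    coalition, so the class, which is the whole graph, is a single vertex.  With
    two classes, either some class forms a coalition, necessarily with the other
    one, and then the whole vertex set is independent; or both classes are
    singleton dominating sets, and a graph partitioned into such sets is complete
    ([dominating_singletons_complete]). *)

Set Implicit Arguments.
Unset Strict Implicit.
Unset Printing Implicit Defensive.

Definition is_complete (G : sgraph) := forall x y : G, adj x y = (x != y).

Definition edgeless (G : sgraph) := forall x y : G, adj x y = false.

Lemma enum_rank_cast_bij (T : finType) m (Tm : #|T| = m) :
  bijective (cast_ord Tm \o @enum_rank T).
Proof.
apply: bij_comp; last exact: enum_rank_bij.
exact: Bijective (cast_ordK _) (cast_ordKV _).
Qed.

(** Adjacency in a complete graph depends only on whether the two vertices are
    equal, so that any bijection is an isomorphism. *)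
Lemma iso_completeP (G : sgraph) m :
  isomorphic G (complete m) <-> #|G| = m /\ is_complete G.
Proof.
split=> [[f bij_f adj_f] | [Gm cG]].
  split=> [|x y]; first by rewrite (bij_eq_card bij_f) card_ord.
  by rewrite -adj_f /= (bij_eq bij_f).
have bij_f := enum_rank_cast_bij Gm.
by exists (cast_ord Gm \o enum_rank) => // x y; rewrite cG -(bij_eq bij_f).
Qed.

Lemma iso_edgelessP (G : sgraph) m :
  isomorphic G (complement (complete m)) <-> #|G| = m /\ edgeless G.
Proof.
split=> [[f bij_f adj_f] | [Gm eG]].
  split=> [|x y]; first by rewrite (bij_eq_card bij_f) card_ord.
  by rewrite -adj_f /= negbK andNb.
exists (cast_ord Gm \o enum_rank); first exact: enum_rank_cast_bij.
by move=> x y; rewrite eG /= negbK andNb.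
Qed.

Section SmallIC.
Variable G : sgraph.
Implicit Types (V W : {set G}) (P : {set {set G}}).

Lemma IC_SomeP t :
  IC G = Some t <->
  (exists2 P : {set {set G}}, ic_partition P & #|P| = t) /\
  (forall P : {set {set G}}, ic_partition P -> #|P| <= t).
Proof.
rewrite /IC; split=> [|[[P icP Pt] le_t]].
  case: existsP => // -[P0 icP0] [<-]; split=> [|P icP]; last exact: leq_bigmax_cond.
  have: 0 < #|[pred P : {set {set G}} | ic_partition P]|.
    by apply/card_gt0P; exists P0.
  by case/(eq_bigmax_cond (fun P : {set {set G}} => #|P|)) => P icP ->; exists P.
case: existsP => [_|[]]; last by exists P.
congr Some; apply/eqP; rewrite eqn_leq; apply/andP; split.
  exact/bigmax_leqP.
by rewrite -Pt; apply: leq_bigmax_cond.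
Qed.

Lemma leq_card_partition P : partition P [set: G] -> #|P| <= #|G|.
Proof.
move=> pP; rewrite -cardsT (card_partition pP) -sum1_card.
apply: leq_sum => V VP; rewrite card_gt0; apply: contraTneq VP => ->.
by case/and3P: pP.
Qed.

Lemma ic_partition_class P V : ic_partition P -> V \in P ->
  (#|V| == 1) && dominating V
  \/ exists W, [/\ W \in P, W != V & independent_coalition V W].
Proof.
case/andP=> _ /forall_inP icP /icP/orP[|/andP[_ /exists_inP[W]]]; first by left.
by rewrite !inE => /andP[neWV WP] cVW; right; exists W.
Qed.

Lemma coalition_cover_edgeless V W :
  independent_coalition V W -> V :|: W = [set: G] -> edgeless G.
Proof.
case/and5P=> _ _ _ _ /andP[_ /andP[indU _]] VWT x y; apply: negbTE.
move/forall_inP: indU => /(_ x); rewrite VWT inE => /(_ isT)/forall_inP.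
by apply; rewrite inE.
Qed.

(** The class of any vertex [y] must be [[set y]], and that this singleton
    dominates means that [y] is adjacent to every other vertex. *)
Lemma dominating_singletons_complete P :
  partition P [set: G] -> (forall V, V \in P -> (#|V| == 1) && dominating V) ->
  is_complete G.
Proof.
move=> pP singP x y; case: eqVneq => [->|neq_xy]; first exact: adj_irr.
have: y \in cover P by rewrite (cover_partition pP) inE.
case/bigcupP=> V /singP/andP[/cards1P[z ->] /forallP/(_ x)].
rewrite !inE => domz /eqP eq_yz; rewrite -eq_yz (negPf neq_xy) /= in domz.
by case/exists_inP: domz => u; rewrite inE => /eqP->.
Qed.

Lemma partition_singletons : partition [set [set x] | x : G] [set: G].
Proof.
apply/and3P; split.
- apply/eqP/setP=> x; rewrite inE; apply/bigcupP.
  by exists [set x]; [apply: imset_f | apply: set11].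
- apply/trivIsetP=> _ _ /imsetP[x _ ->] /imsetP[y _ ->] neq.
  by rewrite disjoints1 inE; apply: contraNneq neq => ->.
- by apply/imsetP=> -[x _ /setP/(_ x)]; rewrite !inE eqxx.
Qed.

Lemma IC_complete : is_complete G -> IC G = Some #|G|.
Proof.
move=> cG; apply/IC_SomeP; split; last by move=> P /andP[/leq_card_partition].
exists [set [set x] | x : G]; last by rewrite card_imset //; apply: set1_inj.
rewrite /ic_partition partition_singletons; apply/forall_inP=> _ /imsetP[x _ ->].
rewrite cards1 eqxx; apply/orP; left; apply/forallP=> y; rewrite inE.
case: eqVneq => //= neq_yx; apply/exists_inP.
by exists x; rewrite ?set11 // cG.
Qed.

Lemma edgeless_independent V : edgeless G -> independent V.
Proof.
by move=> eG; apply/forall_inP=> x _; apply/forall_inP=> y _; rewrite eG.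
Qed.

Lemma edgeless_dominating V : edgeless G -> dominating V = (V == [set: G]).
Proof.
move=> eG; apply/forallP/eqP=> [domV|-> x]; last by rewrite inE.
apply/setP=> x; rewrite inE; case/orP: (domV x) => // /exists_inP[y _].
by rewrite eG.
Qed.

Lemma partition_setC V : V != set0 -> ~: V != set0 ->
  partition [set V; ~: V] [set: G].
Proof.
move=> V0 VC0.
have dVC : [disjoint V & ~: V] by rewrite -setI_eq0 setICr.
apply/and3P; split.
- by apply/eqP/setP=> x; rewrite /cover bigcup_setU !big_set1 setUCr.
- apply/trivIsetP=> A B /set2P[]-> /set2P[]->; rewrite ?eqxx // => _ //.
  by rewrite disjoint_sym.
- by rewrite !inE negb_or ![set0 == _]eq_sym V0.
Qed.

Lemma edgeless_independent_dominating V :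
  edgeless G -> independent_dominating V = (~: V == set0).
Proof.
move=> eG; rewrite /independent_dominating edgeless_independent //.
by rewrite edgeless_dominating // -(inj_eq (@setC_inj G)) setCT.
Qed.

Lemma edgeless_ic_partition V : edgeless G -> V != set0 -> ~: V != set0 ->
  ic_partition [set V; ~: V].
Proof.
move=> eG V0 VC0; rewrite /ic_partition partition_setC //.
apply/forall_inP=> W WP.
have [W0 WC0 WCP] : [/\ W != set0, ~: W != set0 & ~: W \in [set V; ~: V]].
  by case/set2P: WP => ->; rewrite ?setCK ?set21 ?set22.
apply/orP; right; rewrite edgeless_independent_dominating // WC0 /=.
apply/exists_inP; exists (~: W).
  rewrite in_setD1 WCP andbT; have [z zW] := set0Pn _ W0.
  by apply/eqP=> /setP/(_ z); rewrite inE zW.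
rewrite /independent_coalition !edgeless_independent //.
rewrite !edgeless_independent_dominating // setCK W0 WC0 setUCr setCT eqxx.
by rewrite -setI_eq0 setICr eqxx.
Qed.

(** The classes of a coalition already cover the whole graph, which leaves no
    vertex for a third class. *)
Lemma edgeless_ic_partition_le2 P :
  edgeless G -> 1 < #|G| -> ic_partition P -> #|P| <= 2.
Proof.
move=> eG gt1 icP.
have /and3P[/eqP covP /trivIsetP tP P0] : partition P [set: G].
  by case/andP: icP.
have /card_gt0P[z _] := ltnW gt1.
have /bigcupP[V VP _] : z \in cover P by rewrite covP inE.
case: (ic_partition_class icP VP) => [/andP[/eqP V1]|[W [WP _]]].
  rewrite edgeless_dominating // => /eqP VT.
  by rewrite -cardsT -VT V1 in gt1.
case/and5P=> _ _ _ _ /andP[_ /andP[_]].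
rewrite edgeless_dominating // => /eqP VWT.
apply: leq_trans (_ : #|[set V; W]| <= 2); last by rewrite cards2; case: eqP.
apply/subset_leq_card/subsetP=> U UP; rewrite !inE; apply: contraNT P0.
rewrite negb_or => /andP[neqUV neqUW].
suff <- : U = set0 by [].
(* [U] meets neither [V] nor [W], which together cover the graph. *)
by apply/eqP; rewrite -[U]setIT -VWT setIUr setU_eq0 !setI_eq0 !tP.
Qed.

Lemma IC_edgeless : edgeless G -> 1 < #|G| -> IC G = Some 2.
Proof.
move=> eG gt1; apply/IC_SomeP; split; last first.
  by move=> P; apply: edgeless_ic_partition_le2.
case/card_gt1P: gt1 => x [y] [_ _ neq_xy].
have x0 : [set x] != set0 by apply/set0Pn; exists x; rewrite set11.
have yC0 : ~: [set x] != set0 by apply/set0Pn; exists y; rewrite !inE eq_sym.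
exists [set [set x]; ~: [set x]]; first exact: edgeless_ic_partition.
rewrite cards2; suff -> : [set x] != ~: [set x] by [].
by apply/eqP=> /setP/(_ x); rewrite !inE eqxx.
Qed.

Lemma IC1_card : IC G = Some 1 -> #|G| = 1.
Proof.
case/IC_SomeP=> -[P icP /eqP/cards1P[V defP]] _.
have /cover_partition : partition P [set: G] by case/andP: icP.
rewrite /cover defP big_set1 => VT.
have VP : V \in P by rewrite defP set11.
case: (ic_partition_class icP VP) => [/andP[/eqP <- _]|]; first by rewrite VT cardsT.
by case=> W []; rewrite defP inE => ->.
Qed.

Lemma IC2_cases : IC G = Some 2 ->
  (#|G| = 2 /\ is_complete G) \/ (1 < #|G| /\ edgeless G).
Proof.
case/IC_SomeP=> -[P icP P2] _.
have pP : partition P [set: G] by case/andP: icP.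
have gt1 : 1 < #|G| by rewrite -P2 leq_card_partition.
have [/forall_inP singP|] := boolP [forall V in P, (#|V| == 1) && dominating V].
  left; split; last exact: dominating_singletons_complete singP.
  rewrite -cardsT (card_partition pP) -P2 -sum1_card.
  by apply: eq_bigr => V /singP/andP[/eqP].
case/forall_inPn=> V VP nsing; right; split=> //.
case: (ic_partition_class icP VP) => [sing|[W [WP neqWV coal]]].
  by rewrite sing in nsing.
apply: (coalition_cover_edgeless coal).
(* [P] has only two classes, so the coalition of [V] and [W] covers the graph. *)
suff defP : [set V; W] = P.
  by rewrite -(cover_partition pP) -defP /cover bigcup_setU !big_set1.
apply/eqP; rewrite eqEcard P2 cards2 eq_sym neqWV leqnn andbT.
by apply/subsetP=> U /set2P[]->.
Qed.

End SmallIC.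

Theorem proposition4p3 (G : sgraph) (n : nat)
    (G_nonempty : 0 < #|G|) (G_order : #|G| = n) :
  (IC G = Some 1 <-> isomorphic G (complete 1)) /\
  (IC G = Some 2 <->
     isomorphic G (complete 2) \/
     exists m : nat, 2 <= m /\ isomorphic G (complement (complete m))).
Proof.
split; split.
- move=> /IC1_card G1; apply/iso_completeP; split=> // x y.
  have /card_le1_eqP eqG : #|G| <= 1 by rewrite G1.
  by rewrite (eqG x y) // eqxx adj_irr.
- by case/iso_completeP=> <-; apply: IC_complete.
- case/IC2_cases=> [G2|[gt1 eG]]; first by left; apply/iso_completeP.
  by right; exists #|G|; split=> //; apply/iso_edgelessP.
- case=> [/iso_completeP[<-]|[m [gt1 /iso_edgelessP[Gm eG]]]].
    exact: IC_complete.
  by apply: IC_edgeless; rewrite ?Gm.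
Qed.
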